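(* Assume that the following conditions hold. (A1) The Markov chain $(Z(t))$ is irreducible on $E\subset\mathbb{Z}^d$. (A2) There are $C>0$ and $\delta_0>0$ such that $\sup_{\alpha\in\mathbb{R}^d:\|\alpha\|\le\delta_0}\sup_{x\in E}\mathbb{E}_x\bigl(\exp(\alpha\cdot(Z(1)-x))\bigr)<C$. (A3') $0\in E$ and for any $u\in E$: $E+u\subset E$ and $p(x+u,y+u)\ge p(x,y)$ for all $x,y\in E$. (A4') For any $u\in E\setminus\{0\}$ there is $\tilde n_u\in\mathbb{N}$ such that $\inf_{x\in E}\mathbb{P}_x(Z(\tilde n_u)=x+u)>0$. Let $(y_n)$ be a sequence of points of $E$ with $\lim_n\|y_n\|=+\infty$ and $\liminf_{n\to\infty}\frac{1}{\|y_n\|}\log G(0,y_n)\ge 0$. Then for any subsequence $(y_{n_k})$ converging in the Martin compactification $E_M$ to a point $\eta$, the limit function $$K(z,\eta)=\lim_{k\to\infty}K(z,y_{n_k}),\quad z\in E,$$ satisfies $$K(z+u,\eta)\ge K(z,\eta)\qquad\text{for all } z,u\in E.$$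
   Context: $(Z(t))_{t\in\mathbb{N}}$ is a transient sub-stochastic time-homogeneous Markov chain on a countable set $E\subset\mathbb{Z}^d$ with transition probabilities $p(x,y)$, $x,y\in E$ ($\sum_{y\in E}p(x,y)\le1$), completed by an absorbing state $\vartheta$ with $p(x,\vartheta)=1-\sum_{y\in E}p(x,y)$. $\mathbb{P}_x,\mathbb{E}_x$ refer to the initial state $Z(0)=x$; expectations of functions of $Z(1)$ are taken over $Z(1)\in E$ only. $G(x,y)=\sum_{n\ge0}\mathbb{P}_x(Z(n)=y)$ is the Green function and $K(x,y)=G(x,y)/G(0,y)$, $x,y\in E$, the Martin kernel with reference point $0$. A sequence of points $(y_n)$ of $E$ converges in the Martin compactification $E_M$ to a point $\eta$ of the Martin boundary $\partial_ME=E_M\setminus E$ iff it leaves every finite subset of $E$ and the functions $K(\cdot,y_n)$ converge pointwise on $E$; the limit function is denoted $K(\cdot,\eta)$. $\|\cdot\|$ is the Euclidean norm and $\cdot$ the usual scalar product. *)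

(* Defs.v *)
From HB Require Import structures.
From mathcomp Require Export all_boot all_order all_algebra.
From mathcomp Require Export all_classical all_reals all_analysis.
Set Implicit Arguments.
Unset Strict Implicit.
Unset Printing Implicit Defensive.
Export Order.TTheory GRing.Theory Num.Theory.
Export numFieldNormedType.Exports.
Local Open Scope classical_set_scope.
Local Open Scope ring_scope.

Section lattice.
Context {R : realType} {d : nat}.

(* The library norm `|_| on row vectors is the sup norm, hence this one. *)
Definition enorm (a : 'rV[R]_d) : R := Num.sqrt (\sum_(i < d) a 0 i ^+ 2).

Definition dot (a b : 'rV[R]_d) : R := \sum_(i < d) a 0 i * b 0 i.

Definition embed (x : 'rV[int]_d) : 'rV[R]_d := map_mx (fun k : int => k%:~R) x.

End lattice.

Section markov_chain.
Context {R : realType} {d : nat}.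
Variables (E : set 'rV[int]_d) (p : 'rV[int]_d -> 'rV[int]_d -> R).

(* Only the values p x y with x, y in E are meaningful. *)
Definition substochastic : Prop :=
  (forall x y, E x -> E y -> 0 <= p x y) /\
  (forall x, E x -> (\esum_(y in E) (p x y)%:E <= 1)%E).

(* The completed chain lives in E together with the absorbing state None. *)
Definition completed (s t : option 'rV[int]_d) : R :=
  match s, t with
  | Some x, Some y => if y \in E then p x y else 0
  | Some x, None => 1 - fine (\esum_(y in E) (p x y)%:E)
  | None, Some _ => 0
  | None, None => 1
  end.

Context {disp : measure_display} {Omega : measurableType disp}.
(* P x is the law of the chain started at x, meaningful for x in E. *)
Variables (P : 'rV[int]_d -> probability Omega R)
          (Z : nat -> Omega -> option 'rV[int]_d).

(* The Markov property is stated in product form, which avoids conditioning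
   on null events. *)
Record is_markov_chain : Prop := IsMarkovChain {
  chain_measurable : forall t s, measurable (Z t @^-1` [set s]) ;
  chain_state : forall t omega x, Z t omega = Some x -> E x ;
  chain_init : forall x, E x -> P x (Z 0 @^-1` [set Some x]) = 1%E ;
  chain_step : forall x, E x ->
    forall (t : nat) (s : nat -> option 'rV[int]_d),
      P x [set omega | forall i, (i <= t.+1)%N -> Z i omega = s i] =
      (P x [set omega | forall i, (i <= t)%N -> Z i omega = s i] *
         (completed (s t) (s t.+1))%:E)%E
}.

Definition prob_at (x : 'rV[int]_d) (n : nat) (y : 'rV[int]_d) : \bar R :=
  P x (Z n @^-1` [set Some y]).

(* The default 0 in odflt is never used on the domain of integration. *)
Definition exp_moment (a : 'rV[R]_d) (x : 'rV[int]_d) : \bar R :=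
  (\int[P x]_(omega in Z 1%N @^-1` (Some @` E))
     (expR (dot a (embed (odflt 0 (Z 1%N omega) - x))))%:E)%E.

Definition green (x y : 'rV[int]_d) : \bar R :=
  (\sum_(0 <= n <oo) prob_at x n y)%E.

Definition transient : Prop := forall x y, E x -> E y -> (green x y < +oo)%E.

Definition irreducible_chain : Prop :=
  forall x y, E x -> E y -> exists n, (0 < prob_at x n y)%E.

(* Meant for a transient irreducible chain: then both values of the Green
   function are finite and the denominator is nonzero. *)
Definition martin_kernel (x y : 'rV[int]_d) : R :=
  fine (green x y) / fine (green 0 y).

(* Convergence of w in the Martin compactification to a point eta of the
   Martin boundary; eta is represented by its function Keta = K(., eta),
   which determines it and is only relevant on E. *)
Definition martin_cvg (w : nat -> 'rV[int]_d) (Keta : 'rV[int]_d -> R) : Prop :=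
  [/\ forall n, E (w n),
      forall F : set 'rV[int]_d, finite_set F -> F `<=` E ->
        \forall n \near \oo, ~ F (w n)
    & forall z, E z -> martin_kernel z (w n) @[n --> \oo] --> Keta z].

End markov_chain.

(* Main.v *)
Require Import Defs.
From mathcomp Require Import measurable_realfun ring lra zify.
Set Implicit Arguments.
Unset Strict Implicit.
Unset Printing Implicit Defensive.
Local Open Scope classical_set_scope.
Local Open Scope ring_scope.

(** Fix [u <> 0] in [E] and write [T f x = f (x + u)].  By uniform positivity,
    some power [M] of the transition operator charges the jump by [u] with mass
    at least [q > 0] from every state, so [M = S + q T] with [S] nonnegative, and
    the monotonicity of [p] along [E] gives [M T <= T M].  Expand [M^k] into
    words in [S] and [q T].  The chain uses the letter [T] about [q k] times out
    of [k], and the proportion is below [(1 - 2 sg) q] only with exponentially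
    small probability (Chernoff).  Deleting one letter [T] at an arbitrary place
    and putting it in front can only increase a word, by [M T <= T M]; counting
    the choices of the letter deleted gives
      [T M^(k-1) f >= (1 - 3 sg) M^k f - (exponentially small in k)].
    This is [shift_almost_dominates].

    Sum over [k] with [f] chosen so that [sum_k M^k f] is the Green function
    [G(., y)].  The terms with [k] at least a small multiple of the norm of [y]
    contribute an error exponentially small in that norm.  For the other terms
    no comparison is made: by the exponential moment bound, going to distance
    [r] in so few steps is itself exponentially unlikely ([prob_at_decay]).
    Hence [(1 - 3 sg) G(z, y) <= G(z + u, y) + D exp(- c |y|)], which is
    [green_shift].  Since [G(0, y_n)] decays more slowly than any exponential of
    the norm of [y_n], dividing by it makes the error vanish in the limit, and
    [sg] is arbitrary. *)

(** * Elementary exponential estimates *)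

Section exponents.
Context {R : realType}.

(** Chernoff estimate for at most [a] successes among [k] trials of success
    probability [q], with damping factor [1 - sg] per success.  It relies on
    [1 / (1 - sg) <= exp (sg / (1 - sg))] and [1 - sg q <= exp (- sg q)]; the
    frequency threshold [(1 - 2 sg) q] is low enough for the second effect to
    win, leaving the rate [q sg^2 / (1 - sg)]. *)
Lemma expR_damping (sg q : R) (a k : nat) : 0 < sg -> sg < 1 -> 0 < q ->
  0 <= 1 - sg * q -> a%:R <= (1 - 2 * sg) * q * k%:R ->
  ((1 - sg) ^+ a)^-1 * (1 - sg * q) ^+ k <=
    expR (- (q * sg ^+ 2 / (1 - sg) * k%:R)).
Proof.
move=> sg0 sg1 q0 sgq ak.
have s0 : 0 < 1 - sg by rewrite subr_gt0.
pose t := sg / (1 - sg).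
have le1 : (1 - sg)^-1 <= expR t.
  have -> : (1 - sg)^-1 = 1 + t by rewrite /t; field; rewrite gt_eqF.
  exact: expR_ge1Dx.
have le2 : 1 - sg * q <= expR (- (sg * q)) by exact: expR_ge1Dx.
rewrite -exprVn.
apply: (@le_trans _ _ (expR t ^+ a * expR (- (sg * q)) ^+ k)).
  by rewrite ler_pM ?exprn_ge0 ?lerXn2r ?nnegrE ?invr_ge0 ?expR_ge0 ?(ltW s0).
rewrite -!expRM_natr -expRD ler_expR.
have t0 : 0 <= t by rewrite divr_ge0 ?ltW.
apply: (@le_trans _ _ (t * ((1 - 2 * sg) * q * k%:R) + - (sg * q) * k%:R)).
  by rewrite lerD2r ler_wpM2l.
by rewrite le_eqVlt; apply/orP; left; apply/eqP; rewrite /t; field; rewrite gt_eqF.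
Qed.

(** Below [a], the weight [s^(j - a)] is at least [1]; from [a] on, truncated
    subtraction vanishes. *)
Lemma subn_le_geometric (s : R) (a j : nat) : 0 < s -> s <= 1 ->
  (a - j)%N%:R <= a%:R * (s ^+ a)^-1 * s ^+ j.
Proof.
move=> s0 s1; have [aj|ja] := leqP a j.
  rewrite (eqP (_ : (a - j)%N == 0%N)) ?subn_eq0//.
  by rewrite !mulr_ge0 ?invr_ge0 ?exprn_ge0 ?(ltW s0)// ler0n.
have -> : a%:R * (s ^+ a)^-1 * s ^+ j = a%:R * (s ^+ (a - j))^-1.
  rewrite -mulrA; congr (_ * _); rewrite -[in LHS](subnK (ltnW ja)) exprD invfM.
  by rewrite -mulrA mulVf ?mulr1// expf_neq0 ?gt_eqF.
rewrite -[leLHS]mulr1 ler_pM ?ler0n ?ler_nat ?leq_subr//.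
by rewrite invf_ge1 ?exprn_gt0// exprn_ile1 ?(ltW s0).
Qed.

Lemma geometric_sum_le (r : R) N : 0 <= r -> r < 1 ->
  \sum_(k < N) r ^+ k <= (1 - r)^-1.
Proof.
move=> r0 r1; rewrite -[leRHS]mul1r ler_pdivlMr ?subr_gt0//.
have := subrX1 r N; set S := \sum_(k < N) _ => rN.
have : 0 <= r ^+ N by rewrite exprn_ge0.
by lra.
Qed.

End exponents.

(** * Sums of nonnegative families and the operator of a kernel *)

Section nonnegative_sums.
Context {R : realType} {T : choiceType}.
Implicit Types (E F : set T) (f g : T -> \bar R).
Local Open Scope ereal_scope.

Lemma esumZl E (c : R) f : (0 <= c)%R -> (forall w, E w -> 0 <= f w) ->
  \esum_(w in E) (c%:E * f w) = c%:E * \esum_(w in E) f w.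
Proof.
move=> c0 f0; rewrite /esum -ereal_supZl//; last first.
  by apply/set0P; exists (\sum_(w \in set0) f w), set0 => //; exact: fsets_set0.
have distr F : fsets E F ->
    \sum_(w \in F) (c%:E * f w) = c%:E * \sum_(w \in F) f w.
  move=> [finF FE]; rewrite !fsbig_finite//= big_seq [in RHS]big_seq.
  by rewrite ge0_sume_distrr// => w; rewrite in_fset_set// inE => /FE/f0.
congr ereal_sup; apply/seteqP; split=> [_ [F EF <-]|_ [_ [F EF <-] <-]].
  by exists (\sum_(w \in F) f w); [exists F|rewrite distr].
by exists F; last exact: distr.
Qed.

Lemma esum_le_subset E F f : E `<=` F -> (forall w, F w -> 0 <= f w) ->
  \esum_(w in E) f w <= \esum_(w in F) f w.
Proof.
move=> EF f0; rewrite (esumID E F)//.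
have -> : F `&` E = E by apply/setIidPr.
by rewrite leeDl// esum_ge0// => w [/f0].
Qed.

End nonnegative_sums.

Lemma esum_exchange {R : realType} {T U : choiceType} (E : set T) (F : set U)
    (f : T -> U -> \bar R) :
  (forall i j, E i -> F j -> 0 <= f i j)%E ->
  (\esum_(i in E) \esum_(j in F) f i j = \esum_(j in F) \esum_(i in E) f i j)%E.
Proof.
move=> f0; rewrite esum_esum// esum_esum; last by move=> j i Fj Ei; exact: f0.
rewrite (reindex_esum (F `*` E) _ (fun x => (x.2, x.1)))//; split=> //=.
- by move=> [i j] [/=].
- by move=> [i1 i2] [j1 j2] /= _ _ [] -> ->.
- by move=> [i1 i2] [Pi1 Qi2] /=; exists (i2, i1).
Qed.

Section kernels.
Context {R : realType} {T : choiceType} (E : set T).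
Implicit Types (k : T -> T -> R) (f g : T -> \bar R).
Local Open Scope ereal_scope.

Definition kernel_op k f (x : T) : \bar R := \esum_(w in E) ((k x w)%:E * f w).

Variable k : T -> T -> R.
Hypothesis k_ge0 : forall x w, E x -> E w -> (0 <= k x w)%R.

Lemma kernel_op_ge0 f x : (forall w, E w -> 0 <= f w) -> E x ->
  0 <= kernel_op k f x.
Proof.
move=> f0 Ex; apply: esum_ge0 => w Ew.
by rewrite mule_ge0 ?lee_fin ?k_ge0 ?f0.
Qed.

Lemma le_kernel_op f g x : (forall w, E w -> f w <= g w) -> E x ->
  kernel_op k f x <= kernel_op k g x.
Proof.
move=> fg Ex; apply: le_esum => w Ew.
by rewrite lee_wpmul2l ?lee_fin ?k_ge0 ?fg.
Qed.

Lemma kernel_opD f g x : (forall w, E w -> 0 <= f w) ->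
  (forall w, E w -> 0 <= g w) -> E x ->
  kernel_op k (fun w => f w + g w) x = kernel_op k f x + kernel_op k g x.
Proof.
move=> f0 g0 Ex; rewrite -esumD; last 2 first.
- by move=> w Ew; rewrite mule_ge0 ?lee_fin ?k_ge0 ?f0.
- by move=> w Ew; rewrite mule_ge0 ?lee_fin ?k_ge0 ?g0.
by apply: eq_esum => w Ew; rewrite ge0_muleDr ?f0 ?g0.
Qed.

Lemma kernel_opZ (c : R) f x : (0 <= c)%R -> (forall w, E w -> 0 <= f w) ->
  E x -> kernel_op k (fun w => c%:E * f w) x = c%:E * kernel_op k f x.
Proof.
move=> c0 f0 Ex; rewrite -esumZl//; last first.
  by move=> w Ew; rewrite mule_ge0 ?lee_fin ?k_ge0 ?f0.
by apply: eq_esum => w Ew; rewrite muleCA.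
Qed.

End kernels.

(** * Moving a shift to the front of a product of kernels *)

Section shifted_kernel.
Context {R : realType} {V : choiceType} (E : set V) (tau : V -> V).
Hypothesis tau_E : forall x, E x -> E (tau x).
Hypothesis tau_inj : injective tau.
Variable m : V -> V -> R.
Hypothesis m_ge0 : forall x w, E x -> E w -> (0 <= m x w)%R.
Hypothesis m_tau : forall x w, E x -> E w -> (m x w <= m (tau x) (tau w))%R.
Hypothesis m_mass : forall x, E x -> (\esum_(w in E) (m x w)%:E <= 1)%E.
Variable q : R.
Hypothesis q_gt0 : (0 < q)%R.
Hypothesis q_le_m : forall x, E x -> (q <= m x (tau x))%R.
Local Open Scope ereal_scope.

(** The kernel of [S] in the decomposition [M = S + q T], where [M] is the
    operator of [m] and [T f] is [f \o tau]. *)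
Let residual (x w : V) : R := (m x w - (if w == tau x then q else 0))%R.

Let residual_ge0 x w : E x -> E w -> (0 <= residual x w)%R.
Proof.
move=> Ex Ew; rewrite /residual; case: eqP => [->|_].
  by rewrite subr_ge0 q_le_m.
by rewrite subr0 m_ge0.
Qed.

Let q_le1 x : E x -> (q <= 1)%R.
Proof.
move=> Ex; rewrite -lee_fin (le_trans _ (m_mass Ex))//.
apply: (@le_trans _ _ (\esum_(w in [set tau x]) (m x w)%:E)).
  by rewrite esum_set1 lee_fin ?q_le_m ?m_ge0//; exact: tau_E.
apply: esum_le_subset => [_ ->|w Ew]; first exact: tau_E.
by rewrite lee_fin m_ge0.
Qed.

Let kernel_split f x : (forall w, E w -> 0 <= f w) -> E x ->
  kernel_op E m f x = kernel_op E residual f x + q%:E * f (tau x).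
Proof.
move=> f0 Ex.
have -> : q%:E * f (tau x) =
    \esum_(w in E) ((if w == tau x then q else 0%R)%:E * f w).
  rewrite (esumID [set tau x])//; last first.
    by move=> w Ew; rewrite mule_ge0 ?f0// lee_fin; case: ifP; rewrite // ltW.
  rewrite [X in _ + X]esum1 ?adde0; last first.
    by move=> w [_ /eqP/negPf ->]; rewrite mul0e.
  have -> : E `&` [set tau x] = [set tau x].
    by apply/setIidPr => _ ->; exact: tau_E.
  by rewrite esum_set1 eqxx// mule_ge0 ?lee_fin ?(ltW q_gt0) ?f0//; exact: tau_E.
rewrite -esumD; last 2 first.
- by move=> w Ew; rewrite mule_ge0 ?f0// lee_fin residual_ge0.
- by move=> w Ew; rewrite mule_ge0 ?f0// lee_fin; case: ifP; rewrite // ltW.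
apply: eq_esum => w Ew; rewrite -ge0_muleDl; last 2 first.
- by rewrite lee_fin residual_ge0.
- by rewrite lee_fin; case: ifP; rewrite // ltW.
by rewrite -EFinD subrK.
Qed.

(** [M T <= T M]: paths translated by [tau] are at least as likely as the
    original ones, and paths avoiding the image of [tau] only add mass. *)
Lemma kernel_op_comp_shift f x : (forall w, E w -> 0 <= f w) -> E x ->
  kernel_op E m (f \o tau) x <= kernel_op E m f (tau x).
Proof.
move=> f0 Ex; rewrite /kernel_op.
apply: (@le_trans _ _ (\esum_(w in E) ((m (tau x) (tau w))%:E * f (tau w)))).
  by apply: le_esum => w Ew; rewrite lee_wpmul2r ?lee_fin ?m_tau ?f0//; exact: tau_E.
rewrite -(esum_image E tau (fun v => (m (tau x) v)%:E * f v)); last first.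
  by move=> ? ? _ _; exact: tau_inj.
apply: esum_le_subset => [_ [w Ew <-]|w Ew]; first exact: tau_E.
by rewrite mule_ge0 ?f0// lee_fin m_ge0//; exact: tau_E.
Qed.

Variables (f : nat -> V -> \bar R) (B : R).
Hypothesis f_ge0 : forall k x, E x -> 0 <= f k x.
Hypothesis fS : forall k x, E x -> f k.+1 x = kernel_op E m (f k) x.
Hypothesis f0_le : forall x, E x -> f 0%N x <= B%:E.

Let f_tau_ge0 k w : E w -> 0 <= q%:E * f k (tau w).
Proof.
by move=> Ew; rewrite mule_ge0 ?lee_fin ?(ltW q_gt0) ?f_ge0//; exact: tau_E.
Qed.

(** Expand [M^k f0] over words of length [k] in [S] and [q T] and weight each
    word by its number of letters [T]; this is the derivative at [s = 1] of
    [(S + s q T)^k f0], computed by the Leibniz rule. *)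
Fixpoint shift_count k : V -> \bar R :=
  if k is k'.+1 then fun x => kernel_op E m (shift_count k') x + q%:E * f k' (tau x)
  else cst 0.

Let shift_count_ge0 k x : E x -> 0 <= shift_count k x.
Proof.
elim: k x => [|k IH] x Ex //=.
by rewrite adde_ge0 ?f_tau_ge0// kernel_op_ge0.
Qed.

(** Each of the [k + 1] positions that the marked letter [T] may occupy
    contributes at most [q T M^k f0], by commuting [T] to the front. *)
Lemma shift_count_le k x : E x ->
  shift_count k.+1 x <= (k.+1%:R * q)%:E * f k (tau x).
Proof.
elim: k x => [|k IH] x Ex.
  rewrite /= /kernel_op esum1 ?add0e ?mul1r// => w _; exact: mule0.
rewrite -/(shift_count k.+1) [leLHS]/= -/(shift_count k.+1).
have -> : (k.+2%:R * q = k.+1%:R * q + q)%R by rewrite -natr1 mulrDl mul1r.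
have kq_ge0 : (0 <= k.+1%:R * q)%R by rewrite mulr_ge0// ltW.
rewrite EFinD ge0_muleDl ?lee_fin ?(ltW q_gt0)// leeD2r//.
have ft0 w : E w -> 0 <= f k (tau w) by move=> Ew; apply: f_ge0; exact: tau_E.
apply: le_trans (le_kernel_op m_ge0
  (g := fun w => (k.+1%:R * q)%:E * f k (tau w)) IH Ex) _.
rewrite (kernel_opZ m_ge0)// lee_wpmul2l ?lee_fin//.
by rewrite (fS _ (tau_E Ex)) (kernel_op_comp_shift (f_ge0 k)).
Qed.

Section damping.
Variable s : R.
Hypothesis s_ge0 : (0 <= s)%R.

(** [(S + s q T)^k f0], that is the expansion of [M^k f0] in which a word with
    [j] letters [T] is damped by [s^j]. *)
Fixpoint damped k : V -> \bar R :=
  if k is k'.+1 then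
    fun x => kernel_op E residual (damped k') x + (s * q)%:E * damped k' (tau x)
  else f 0%N.

Let sq_ge0 : (0 <= s * q)%R. Proof. by rewrite mulr_ge0// ltW. Qed.

Let damped_ge0 k x : E x -> 0 <= damped k x.
Proof.
elim: k x => [|k IH] x Ex /=; first exact: f_ge0.
rewrite adde_ge0 ?(kernel_op_ge0 residual_ge0)//.
by rewrite mule_ge0 ?lee_fin// IH//; exact: tau_E.
Qed.

(** Damping removes the mass [(1 - s) q] from each step of a substochastic
    kernel. *)
Lemma damped_le k x : (s <= 1)%R -> (0 <= B)%R -> E x ->
  damped k x <= ((1 - (1 - s) * q) ^+ k * B)%:E.
Proof.
move=> s1 B0; elim: k x => [|k IH] x Ex /=.
  by rewrite expr0 mul1r f0_le.
set r := (1 - (1 - s) * q)%R; set c := (r ^+ k * B)%R.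
have q1 := q_le1 Ex.
have r0 : (0 <= r)%R by rewrite /r mulrBl mul1r opprB addrCA addr_ge0 ?subr_ge0.
have c0 : (0 <= c)%R by rewrite mulr_ge0// exprn_ge0.
have cst0 (w : V) : E w -> 0 <= cst c%:E w by rewrite /= lee_fin.
have step : kernel_op E residual (cst c%:E) x <= ((1 - q) * c)%:E.
  have : kernel_op E m (cst c%:E) x <= c%:E.
    rewrite /kernel_op; under eq_esum do rewrite muleC.
    rewrite esumZl//; last by move=> w Ew; rewrite lee_fin m_ge0.
    by rewrite -[leRHS]mule1 lee_wpmul2l ?lee_fin ?m_mass.
  rewrite kernel_split//= -EFinM -leeBrDr// -EFinB => /le_trans; apply.
  by rewrite lee_fin; lra.
have -> : (r ^+ k.+1 * B)%:E = ((1 - q) * c)%:E + (s * q)%:E * c%:E.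
  by rewrite -EFinM -EFinD; congr EFin; rewrite /c /r exprS; ring.
apply: leeD.
  by apply: le_trans step; exact: (le_kernel_op residual_ge0).
by rewrite lee_wpmul2l ?lee_fin// IH//; exact: tau_E.
Qed.

(** A word with [j] letters [T] satisfies [a <= j + b s^j] by hypothesis, and
    the claim is the sum of these inequalities over all words.  The induction
    runs on [(a, b)] instead of on words: the hypothesis on [(a, b)] passes to
    [(a - 1, b s)] when a letter [T] is consumed. *)
Lemma shift_count_ge (a : nat) (b : R) k x :
  (forall j, ((a - j)%N%:R <= b * s ^+ j)%R) -> E x ->
  a%:R%:E * f k x <= shift_count k x + b%:E * damped k x.
Proof.
elim: k a b x => [|k IH] a b x ab Ex /=.
  rewrite add0e lee_wpmul2r ?f_ge0// lee_fin.
  by have := ab 0%N; rewrite subn0 expr0 mulr1.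
have b0 : (0 <= b)%R.
  by have := ab 0%N; rewrite expr0 mulr1; apply: le_trans; rewrite ler0n.
case: a ab => [|a] ab.
  rewrite mul0e; apply: adde_ge0; first exact: (@shift_count_ge0 k.+1).
  by apply: mule_ge0; rewrite ?lee_fin//; exact: (@damped_ge0 k.+1).
have bs0 : (0 <= b * s)%R by rewrite mulr_ge0.
have ab' j : ((a - j)%N%:R <= b * s * s ^+ j)%R.
  by have := ab j.+1; rewrite subSS exprS mulrA.
have Etx := tau_E Ex.
have bd0 w : E w -> 0 <= b%:E * damped k w.
  by move=> Ew; rewrite mule_ge0 ?lee_fin// damped_ge0.
have sum0 w : E w -> 0 <= shift_count k w + b%:E * damped k w.
  by move=> Ew; rewrite adde_ge0 ?bd0 ?shift_count_ge0.
rewrite fS// kernel_split//; last exact: f_ge0.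
rewrite (kernel_split _ Ex); last exact: shift_count_ge0.
set S := kernel_op E residual.
have S1 : a.+1%:R%:E * S (f k) x <= S (shift_count k) x + b%:E * S (damped k) x.
  rewrite -(kernel_opZ residual_ge0)//; last exact: f_ge0.
  rewrite -(kernel_opZ residual_ge0)//; last exact: damped_ge0.
  rewrite -(kernel_opD residual_ge0)//; last exact: shift_count_ge0.
  by apply: (le_kernel_op residual_ge0) => // w Ew; exact: IH.
have S2 : a.+1%:R%:E * (q%:E * f k (tau x)) <= q%:E * shift_count k (tau x)
    + q%:E * f k (tau x) + b%:E * ((s * q)%:E * damped k (tau x)).
  have -> : a.+1%:R%:E * (q%:E * f k (tau x)) =
      q%:E * (a%:R%:E * f k (tau x)) + q%:E * f k (tau x).
    rewrite -natr1 EFinD ge0_muleDl ?lee_fin// mul1e; congr (_ + _).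
    by rewrite muleCA.
  rewrite addeAC leeD2r//.
  have -> : b%:E * ((s * q)%:E * damped k (tau x)) =
      q%:E * ((b * s)%:E * damped k (tau x)).
    by rewrite !muleA -!EFinM; congr (_%:E * _); ring.
  rewrite -ge0_muleDr ?shift_count_ge0//; last first.
    by rewrite mule_ge0 ?lee_fin// damped_ge0.
  by rewrite lee_wpmul2l ?lee_fin ?(ltW q_gt0)//; exact: IH.
rewrite ge0_muleDr ?(kernel_op_ge0 residual_ge0) ?f_tau_ge0//; last exact: f_ge0.
apply: le_trans (leeD S1 S2) _.
rewrite ge0_muleDr ?(kernel_op_ge0 residual_ge0)//; last 2 first.
- exact: damped_ge0.
- by rewrite mule_ge0 ?lee_fin// damped_ge0.
by rewrite [leLHS]addeACA -[X in _ <= X + _]addeA.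
Qed.

End damping.

(** Compare the two bounds on the number of letters [T] for the threshold
    [a], the integer part of [(1 - 2 sg) q k], and for [b = a s^(-a)] with
    [s = 1 - sg].  The third [sg] pays for taking the integer part, which is
    why [sg q k] has to be at least [1]. *)
Lemma shift_almost_dominates (sg : R) k x : (0 < sg)%R -> (3 * sg <= 1)%R ->
  (0 <= B)%R -> (1 <= sg * q * k.+1%:R)%R -> E x ->
  (1 - 3 * sg)%:E * f k.+1 x <=
    f k (tau x) + (B * expR (- (q * sg ^+ 2 / (1 - sg) * k.+1%:R)))%:E.
Proof.
move=> sg0 sg3 B0 kbig Ex.
have q1 := q_le1 Ex.
have sgq0 : (0 <= 1 - sg * q)%R by nra.
set K : R := k.+1%:R; set e := expR _.
have K0 : (0 < K)%R by rewrite ltr0n.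
pose a := Num.truncn ((1 - 2 * sg) * q * K)%R.
have x0 : (0 <= (1 - 2 * sg) * q * K)%R.
  by rewrite !mulr_ge0 ?(ltW q_gt0) ?(ltW K0)//; lra.
have /andP[a_le a_gt] := truncn_itv x0.
rewrite -/a -natr1 in a_le a_gt.
have aKq : (a%:R <= K * q)%R.
  apply: (le_trans a_le); rewrite -mulrA [(q * K)%R]mulrC.
  by rewrite ler_piMl ?mulr_ge0 ?(ltW q_gt0) ?(ltW K0)//; lra.
have a_ge : ((1 - 3 * sg) * (K * q) <= a%:R)%R.
  have -> : ((1 - 3 * sg) * (K * q) =
    (1 - 2 * sg) * q * K - sg * q * K)%R by ring.
  by rewrite /K; lra.
have s0 : (0 < 1 - sg)%R by lra.
have s1 : (1 - sg <= 1)%R by lra.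
have := shift_count_ge (ltW s0) k.+1
  (fun j => subn_le_geometric a j s0 s1) Ex.
have Kq0 : (0 < K * q)%R by rewrite mulr_gt0.
set b := (a%:R * _)%R.
have b0 : (0 <= b)%R by rewrite mulr_ge0 ?ler0n// invr_ge0 exprn_ge0// ltW.
have bd : b%:E * damped (1 - sg) k.+1 x <= (K * q)%:E * (B * e)%:E.
  apply: (@le_trans _ _ (b%:E * ((1 - (1 - (1 - sg)) * q) ^+ k.+1 * B)%:E)).
    by rewrite lee_wpmul2l ?lee_fin// damped_le// ltW.
  rewrite -!EFinM lee_fin (_ : 1 - (1 - sg) = sg)%R; last by ring.
  rewrite mulrA [(B * e)%R]mulrC mulrA ler_wpM2r// /b -mulrA ler_pM ?ler0n//.
    by rewrite mulr_ge0 ?exprn_ge0// invr_ge0 exprn_ge0// ltW.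
  by apply: expR_damping => //; lra.
move=> main; rewrite -(@lee_pmul2l _ (K * q)%:E) ?lte_fin//.
rewrite ge0_muleDr; last 2 first.
- by rewrite f_ge0//; exact: tau_E.
- by rewrite lee_fin mulr_ge0 ?expR_ge0.
apply: (@le_trans _ _ (a%:R%:E * f k.+1 x)).
  by rewrite muleA -EFinM lee_wpmul2r ?f_ge0// lee_fin mulrC.
apply: (le_trans main); apply: leeD => //.
exact: shift_count_le.
Qed.

End shifted_kernel.

(** * Transition probabilities of a countable chain *)

Section countable_partition.
Context {R : realType} {disp : measure_display} {Omega : measurableType disp}.
Context {C : countType} (X : Omega -> C).
Hypothesis X_fiber : forall c, measurable (X @^-1` [set c]).

Lemma measurable_preimage_countable (A : set C) : measurable (X @^-1` A).
Proof.
have -> : X @^-1` A =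
    \bigcup_c (if c \in A then X @^-1` [set c] else set0).
  apply/seteqP; split=> [w Aw|w [c _]].
    by exists (X w) => //; rewrite mem_set.
  by case: ifPn => // /set_mem Ac /= ->.
by apply: countable_bigcupT_measurable => // c; case: ifP.
Qed.

Lemma measure_countable_partition (mu : {measure set Omega -> \bar R})
    (A : set Omega) : measurable A ->
  mu A = (\esum_(c in [set: C]) mu (A `&` X @^-1` [set c]))%E.
Proof.
move=> mA.
have mF c : measurable (A `&` X @^-1` [set c]) by exact: measurableI.
pose F n := if @pickle_inv C n is Some c then A `&` X @^-1` [set c] else set0.
have FE n w : F n w -> n = pickle (X w).
  rewrite /F -[in n = _](@pickle_invK C n).
  by case: pickle_inv => // c [_ /= ->].
have AE : A = \bigcup_n F n.
  apply/seteqP; split=> [w Aw|w [n _]].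
    by exists (pickle (X w)) => //; rewrite /F pickleK_inv.
  by rewrite /F; case: pickle_inv => // c [].
rewrite [in LHS]AE measure_bigcup//; last 2 first.
- by move=> n _; rewrite /F; case: pickle_inv.
- by move=> i j _ _ [w [/FE -> /FE ->]].
rewrite nneseries_esum; last by move=> n _; exact: measure_ge0.
rewrite (esumID (range (@pickle C))); last by move=> n _; exact: measure_ge0.
rewrite [X in (_ + X)%E]esum1 ?adde0; last first.
  move=> n [_ /= nC]; rewrite /F; case E : pickle_inv => [c|]; last exact: measure0.
  by case: nC; exists c => //; rewrite -[RHS](@pickle_invK C n) E.
have -> : [set n : nat | (n \in [set: nat]) = true] `&` range (@pickle C) = range (@pickle C).
  by apply/setIidPr => n _ /=; rewrite in_setT.
rewrite esum_image; last by move=> ? ? _ _; exact: (pcan_inj pickleK).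
by apply: eq_esum => c _; rewrite /F pickleK_inv.
Qed.


End countable_partition.


Section transition_probabilities.
Context {R : realType} {d : nat}.
Variables (E : set 'rV[int]_d) (p : 'rV[int]_d -> 'rV[int]_d -> R).
Context {disp : measure_display} {Omega : measurableType disp}.
Variables (P : 'rV[int]_d -> probability Omega R)
          (Z : nat -> Omega -> option 'rV[int]_d).
Hypothesis p_sub : substochastic E p.
Hypothesis Z_markov : is_markov_chain E p P Z.
Local Open Scope ereal_scope.
Local Notation prob := (prob_at P Z).

Let p_ge0 x y : E x -> E y -> (0 <= p x y)%R := p_sub.1 x y.

Lemma prob_at_ge0 x n y : 0 <= prob x n y.
Proof. exact: measure_ge0. Qed.

Definition step_kernel n x y : R := fine (prob x n y).

Lemma step_kernelE n x y : (step_kernel n x y)%:E = prob x n y.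
Proof. by rewrite fineK// fin_num_measure//; exact: (chain_measurable Z_markov). Qed.

Lemma step_kernel_ge0 n x y : (0 <= step_kernel n x y)%R.
Proof. by rewrite -lee_fin step_kernelE prob_at_ge0. Qed.

Let traj m t (s : nat -> option 'rV[int]_d) : set Omega :=
  [set w | forall i, (m <= i <= t)%N -> Z i w = s i].

Let measurable_traj m t s : measurable (traj m t s).
Proof.
have -> : traj m t s =
    \bigcap_i (if (m <= i <= t)%N then Z i @^-1` [set s i] else setT).
  apply/seteqP; split=> [w Hw i _|w Hw i it].
    by case: ifP => // /Hw.
  by have := Hw i I; rewrite it.
apply: bigcapT_measurable => i; case: ifP => // _.
exact: (chain_measurable Z_markov).
Qed.

(** The Markov property prescribes whole trajectories from time [0] on.  The
    first coordinates are forgotten one at a time, by summing over their value;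
    the nonnegativity hypothesis makes the common factor distribute over this
    sum. *)
Let traj_step x m t s : E x -> (m <= t)%N ->
  (0 <= completed E p (s t) (s t.+1))%R ->
  P x (traj m t.+1 s) = P x (traj m t s) * (completed E p (s t) (s t.+1))%:E.
Proof.
move=> Ex; elim: m s => [|m IH] s mt c0.
  exact: (chain_step Z_markov Ex t s).
pose s' c i := if i == m then c else s i.
have fiber := chain_measurable Z_markov m.
have trajI t' c : (m <= t')%N ->
    traj m.+1 t' s `&` Z m @^-1` [set c] = traj m t' (s' c).
  move=> mt'; apply/seteqP; split=> [w [Hw Hc] i /andP[mi it]|w Hw].
    rewrite /s'; case: eqP => [->//|/eqP im].
    by apply: Hw; rewrite it andbT ltn_neqAle eq_sym im.
  split=> [i /andP[mi it]|].
    by rewrite Hw ?it ?(ltnW mi)// /s' gtn_eqF.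
  by rewrite /= Hw ?leqnn// /s' eqxx.
rewrite !(measure_countable_partition fiber)// muleC.
rewrite -esumZl//.
apply: eq_esum => c _; rewrite !trajI ?(leq_trans (ltnW mt))// muleC.
have s't : completed E p (s' c t) (s' c t.+1) = completed E p (s t) (s t.+1).
  by rewrite /s' !gtn_eqF// ltnW.
by rewrite -s't in c0 *; exact: IH (ltnW mt) c0.
Qed.

(** The value of [Z n] is either in [E], or absorbed, and then the chain cannot
    come back to [y]. *)
Lemma prob_atS x n y : E x -> E y ->
  prob x n.+1 y = \esum_(w in E) (prob x n w * (p w y)%:E).
Proof.
move=> Ex Ey.
have fiber i := chain_measurable Z_markov i.
rewrite /prob_at (measure_countable_partition (fiber n))//.
pose s c i := if i == n then c else Some y.
have step c : (0 <= completed E p c (Some y))%R ->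
    P x (Z n.+1 @^-1` [set Some y] `&` Z n @^-1` [set c]) =
    P x (Z n @^-1` [set c]) * (completed E p c (Some y))%:E.
  have -> : Z n.+1 @^-1` [set Some y] `&` Z n @^-1` [set c] =
      traj n n.+1 (s c).
    apply/seteqP; split=> [w [Hy Hc] i /andP[ni iSn]|w Hw].
      rewrite /s; case: eqP => [->//|/eqP nin].
      by have -> : i = n.+1 by lia.
    split; first by rewrite /= Hw ?leqnn ?leqnSn// /s gtn_eqF.
    by rewrite /= Hw ?leqnn ?leqnSn// /s eqxx.
  have sn : s c n = c by rewrite /s eqxx.
  have sSn : s c n.+1 = Some y by rewrite /s gtn_eqF.
  move=> c0; rewrite (traj_step Ex (leqnn n)) ?sn ?sSn//.
  congr (P x _ * _); apply/seteqP; split=> [w Hw|w /= Hw i].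
    by rewrite /= Hw ?leqnn// sn.
  by rewrite -eqn_leq => /eqP <-; rewrite Hw sn.
rewrite (esumID (Some @` E)); last by move=> c _; exact: measure_ge0.
rewrite [X in _ + X]esum1 ?adde0; last first.
  move=> [w|] [_ /= nE]; last first.
    by have := step None; rewrite /= mule0; apply.
  rewrite (_ : _ `&` _ = set0) ?measure0//.
  apply/seteqP; split=> // om [_ /= ZSome]; case: nE.
  by exists w => //; exact: (chain_state Z_markov ZSome).
rewrite setTI esum_image => [|? ? _ _ [//]].
apply: eq_esum => w Ew.
have completedE : completed E p (Some w) (Some y) = p w y by rewrite /= mem_set.
have := step (Some w); rewrite completedE; apply; exact: p_ge0.
Qed.

Lemma prob_at0 x y : E x -> prob x 0 y = (x == y)%:R%:E.
Proof.
move=> Ex; have init := chain_init Z_markov Ex; case: eqP => [<-//|xy].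
have mZ := chain_measurable Z_markov 0.
apply: le_anti; rewrite prob_at_ge0 andbT.
have : P x (Z 0 @^-1` [set Some x] `|` Z 0 @^-1` [set Some y]) <= 1.
  by apply: probability_le1; exact: measurableU.
rewrite measureU//; last first.
  by apply/seteqP; split=> // om [/= -> [yx]]; case: xy.
by rewrite [X in X + _](_ : _ = 1) ?init// -[leRHS]adde0 leeD2lE.
Qed.

Lemma prob_at1 x y : E x -> E y -> prob x 1 y = (p x y)%:E.
Proof.
move=> Ex Ey; rewrite prob_atS//.
rewrite (esumID [set x]); last first.
  by move=> w Ew; rewrite mule_ge0 ?prob_at_ge0// lee_fin p_ge0.
have -> : E `&` [set x] = [set x] by apply/setIidPr => _ ->.
rewrite [X in _ + X]esum1 => [|w [_ /eqP/negPf wx]]; last first.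
  by rewrite prob_at0// eq_sym wx mul0e.
by rewrite esum_set1 prob_at0// eqxx mul1e ?adde0// lee_fin p_ge0.
Qed.

Lemma step_kernel_mass n x : \esum_(w in E) (step_kernel n x w)%:E <= 1.
Proof.
have -> : \esum_(w in E) (step_kernel n x w)%:E =
    \esum_(c in Some @` E) P x (Z n @^-1` [set c]).
  rewrite esum_image; last by move=> ? ? _ _ [].
  by apply: eq_esum => w _; exact: step_kernelE.
apply: le_trans (probability_le1 (P x) measurableT).
rewrite (measure_countable_partition (chain_measurable Z_markov n) _ measurableT).
under [leRHS]eq_esum do rewrite setTI.
by apply: esum_le_subset => // c _; exact: measure_ge0.
Qed.

Lemma chapman_kolmogorov x m n y : E x -> E y ->
  prob x (m + n) y = kernel_op E (step_kernel m) (fun w => prob w n y) x.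
Proof.
move=> Ex; elim: n y => [|n IH] y Ey.
  rewrite addn0 /kernel_op (esumID [set y]); last first.
    by move=> w Ew; rewrite mule_ge0 ?prob_at_ge0// lee_fin step_kernel_ge0.
  have -> : E `&` [set y] = [set y] by apply/setIidPr => _ ->.
  rewrite [X in _ + X]esum1 => [|w [Ew /eqP/negPf wy]]; last first.
    by rewrite prob_at0// wy mule0.
  by rewrite esum_set1 ?prob_at0// eqxx mule1 step_kernelE ?adde0// prob_at_ge0.
rewrite addnS prob_atS//.
transitivity (\esum_(v in E) \esum_(w in E)
    ((step_kernel m x w)%:E * (prob w n v * (p v y)%:E))).
  apply: eq_esum => v Ev; rewrite IH// muleC -esumZl ?p_ge0//; last first.
    by move=> w Ew; rewrite mule_ge0 ?prob_at_ge0// lee_fin step_kernel_ge0.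
  by apply: eq_esum => w Ew; rewrite muleC muleA.
rewrite esum_exchange; last first.
  move=> v w Ev Ew; rewrite !mule_ge0 ?prob_at_ge0 ?lee_fin ?p_ge0//.
  exact: step_kernel_ge0.
apply: eq_esum => w Ew; rewrite esumZl ?step_kernel_ge0 ?prob_atS//.
by move=> v Ev; rewrite mule_ge0 ?prob_at_ge0 ?lee_fin ?p_ge0.
Qed.

Lemma prob_at_shift u : (forall x, E x -> E (x + u)%R) ->
  (forall x y, E x -> E y -> (p x y <= p (x + u) (y + u))%R) ->
  forall n x y, E x -> E y -> prob x n y <= prob (x + u)%R n (y + u)%R.
Proof.
move=> Eshift pshift; elim=> [|n IH] x y Ex Ey.
  rewrite (prob_at0 _ Ex) (prob_at0 _ (Eshift x Ex)).
  by have -> : (x + u == y + u)%R = (x == y) := inj_eq (addIr u) x y.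
rewrite (prob_atS _ Ex Ey) (prob_atS _ (Eshift x Ex) (Eshift y Ey)).
have inj : set_inj E (fun w : 'rV[int]_d => (w + u)%R).
  by move=> ? ? _ _; exact: addIr.
apply: (@le_trans _ _
  (\esum_(w in E) (prob (x + u)%R n (w + u)%R * (p (w + u) (y + u))%:E))).
  apply: le_esum => w Ew.
  by apply: lee_pmul; rewrite ?prob_at_ge0 ?lee_fin ?p_ge0 ?pshift ?IH.
pose g v := prob (x + u)%R n v * (p v (y + u))%:E.
have := esum_image E (fun w => w + u)%R g inj; rewrite /g => <-.
apply: esum_le_subset => [_ [w Ew <-]|w Ew]; first exact: Eshift.
by rewrite mule_ge0 ?prob_at_ge0 ?lee_fin ?p_ge0//; exact: Eshift.
Qed.

End transition_probabilities.

(** * Exponential decay of the transition probabilities *)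

Section euclidean.
Context {R : realType} {d : nat}.
Implicit Types (a b : 'rV[R]_d) (x y : 'rV[int]_d).

Lemma enorm_sqr a : enorm a ^+ 2 = dot a a.
Proof.
rewrite sqr_sqrtr; last by rewrite sumr_ge0// => i _; rewrite sqr_ge0.
by apply: eq_bigr => i _; rewrite expr2.
Qed.

Lemma enormZ (c : R) a : 0 <= c -> enorm (c *: a) = c * enorm a.
Proof.
move=> c0; rewrite /enorm -[in RHS](ger0_norm c0) -sqrtr_sqr -sqrtrM ?sqr_ge0//.
congr Num.sqrt; rewrite mulr_sumr; apply: eq_bigr => i _.
by rewrite mxE exprMn.
Qed.

Lemma coord_le_enorm a i : `|a 0 i| <= enorm a.
Proof.
rewrite -sqrtr_sqr ler_wsqrtr// (bigD1 i)//= lerDl sumr_ge0// => j _.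
by rewrite sqr_ge0.
Qed.

Lemma dotZl (c : R) a b : dot (c *: a) b = c * dot a b.
Proof. by rewrite /dot mulr_sumr; apply: eq_bigr => i _; rewrite mxE mulrA. Qed.

Lemma dot_embedB a x y :
  dot a (embed (y - x)) = dot a (embed y) - dot a (embed x).
Proof.
rewrite /dot -sumrB; apply: eq_bigr => i _.
by rewrite !mxE rmorphB /= mulrBr.
Qed.

Lemma dot_embed_le a x : dot a (embed x) <= enorm a * \sum_i `|(x 0 i)%:~R|.
Proof.
rewrite mulr_sumr; apply: ler_sum => i _; rewrite mxE.
by rewrite (le_trans (ler_norm _))// normrM ler_wpM2r// coord_le_enorm.
Qed.

End euclidean.

Section exponential_decay.
Context {R : realType} {d : nat}.
Variables (E : set 'rV[int]_d) (p : 'rV[int]_d -> 'rV[int]_d -> R).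
Context {disp : measure_display} {Omega : measurableType disp}.
Variables (P : 'rV[int]_d -> probability Omega R)
          (Z : nat -> Omega -> option 'rV[int]_d).
Hypothesis p_sub : substochastic E p.
Hypothesis Z_markov : is_markov_chain E p P Z.
Local Open Scope ereal_scope.
Local Notation prob := (prob_at P Z).

(** The expectation dominates the sum over finitely many values of [Z 1], on
    each of which the integrand is constant. *)
Lemma le_exp_moment a x : E x ->
  \esum_(w in E) ((p x w)%:E * (expR (dot a (embed (w - x))))%:E)
    <= exp_moment E P Z a x.
Proof.
move=> Ex; apply: ge_ereal_sup => _ [F [finF FE] <-].
have mZ := measurable_preimage_countable (chain_measurable Z_markov 1).
pose g om := (expR (dot a (embed (odflt 0%R (Z 1%N om) - x))))%:E.
have mg D : measurable D -> measurable_fun D g.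
  move=> mD _ B mB; apply: measurableI => //.
  exact: (mZ [set c | B (expR (dot a (embed (odflt 0%R c - x))))%:E]).
have g0 om : 0 <= g om by rewrite lee_fin expR_ge0.
have [r r_uniq rF] : exists2 r : seq 'rV[int]_d, uniq r & [set` r] = F.
  by have /finite_seqP[r ->] := finF; exists (undup r); rewrite ?undup_uniq//;
    apply/seteqP; split=> w /=; rewrite mem_undup.
rewrite -rF -fsbig_seq//.
pose fiber (w : 'rV[int]_d) := Z 1%N @^-1` [set Some w].
have mfiber w : measurable (fiber w) by exact: mZ.
apply: (@le_trans _ _ (\int[P x]_(om in \big[setU/set0]_(w <- r) fiber w) g om)).
  rewrite ge0_integral_bigsetU//; last 2 first.
  - by move=> w v _ _ [om []]; rewrite /fiber /= => -> [].
  - by apply: mg; exact: bigsetU_measurable.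
  rewrite le_eqVlt; apply/orP; left; apply/eqP.
  rewrite big_seq [RHS]big_seq; apply: eq_bigr => w wr.
  rewrite (eq_integral (cst (expR (dot a (embed (w - x))))%:E)); last first.
    by move=> om /set_mem Zw; rewrite /g (Zw : Z 1%N om = Some w).
  rewrite integral_cst// muleC; congr (_ * _).
  rewrite -(prob_at1 p_sub Z_markov)//.
  by apply: FE; rewrite -rF.
apply: ge0_subset_integral => //.
- exact: bigsetU_measurable.
- exact: mg (mZ _).
- rewrite -bigcup_seq => om [w /= wr] ->.
  by exists w => //; apply: FE; rewrite -rF.
Qed.

Variables (delta K : R).
Hypothesis delta_gt0 : (0 < delta)%R.
Hypothesis exp_moment_le : forall a x, (enorm a <= delta)%R -> E x ->
  exp_moment E P Z a x <= (expR K)%:E.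

(** Iterating the exponential moment bound: the expectation of [exp (a . Z n)] is
    multiplied by at most [exp K] at each step. *)
Lemma prob_at_le_expR a n x y : (enorm a <= delta)%R -> E x -> E y ->
  prob x n y <= (expR (K * n%:R - dot a (embed (y - x))))%:E.
Proof.
move=> adelta; elim: n x => [|n IH] x Ex Ey.
  rewrite mulr0 sub0r (prob_at0 Z_markov _ Ex).
  case: eqP => [<-|_]; last by rewrite lee_fin expR_ge0.
  by rewrite dot_embedB subrr oppr0 expR0.
rewrite -add1n (chapman_kolmogorov p_sub Z_markov)//.
set c := (expR (K * n%:R - dot a (embed (y - x))))%R.
apply: (@le_trans _ _ (\esum_(w in E)
    (c%:E * ((p x w)%:E * (expR (dot a (embed (w - x))))%:E)))).
  apply: le_esum => w Ew.
  rewrite (step_kernelE Z_markov) (prob_at1 p_sub Z_markov)// muleCA.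
  rewrite lee_wpmul2l ?lee_fin ?p_sub.1//.
  rewrite (le_trans (IH _ Ew Ey))// lee_fin -expRD ler_expR !dot_embedB.
  by lra.
rewrite esumZl ?expR_ge0//; last first.
  by move=> w Ew; rewrite mule_ge0// lee_fin ?expR_ge0 ?p_sub.1.
apply: (@le_trans _ _ (c%:E * (expR K)%:E)).
  rewrite lee_wpmul2l ?lee_fin ?expR_ge0//.
  exact: le_trans (le_exp_moment a Ex) (exp_moment_le adelta Ex).
by rewrite -EFinM lee_fin -expRD ler_expR -natr1 mulrDr mulr1 addrAC.
Qed.

Lemma prob_at_decay n x y : E x -> E y ->
  (0 < enorm (embed y : 'rV[R]_d))%R ->
  prob x n y <= (expR (K * n%:R - delta * enorm (embed y : 'rV[R]_d) +
    delta * \sum_i `|(x 0%R i)%:~R|))%:E.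
Proof.
move=> Ex Ey; set r := enorm _ => r0.
(* the direction for which [a . y] is as large as possible *)
pose a : 'rV[R]_d := ((delta / r) *: embed y)%R.
have ea : enorm a = delta.
  by rewrite enormZ ?divr_ge0 ?ltW// -/r divfK// gt_eqF.
have ad : (enorm a <= delta)%R by rewrite ea.
apply: le_trans (prob_at_le_expR n ad Ex Ey) _.
have ay : dot a (embed y) = (delta * r)%R.
  by rewrite dotZl -enorm_sqr -/r expr2 mulrA divfK// gt_eqF.
have := dot_embed_le a x; rewrite ea => ax.
by rewrite lee_fin ler_expR dot_embedB ay; lra.
Qed.

End exponential_decay.

(** * Comparison of the Green functions at [z] and [z + u] *)

Section green_function.
Context {R : realType} {d : nat}.
Variables (E : set 'rV[int]_d) (p : 'rV[int]_d -> 'rV[int]_d -> R).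
Context {disp : measure_display} {Omega : measurableType disp}.
Variables (P : 'rV[int]_d -> probability Omega R)
          (Z : nat -> Omega -> option 'rV[int]_d).
Hypothesis p_sub : substochastic E p.
Hypothesis Z_markov : is_markov_chain E p P Z.
Local Open Scope ereal_scope.
Local Notation prob := (prob_at P Z).
Local Notation norm y := (enorm (embed y : 'rV[R]_d)).

(** The terms of the Green function in blocks of [l] consecutive times, so that
    block [k + 1] is the image of block [k] under [M], the [l]-th power of the
    transition operator. *)
Definition block_prob (l : nat) (y : 'rV[int]_d) k x : \bar R :=
  \sum_(r < l) prob x (l * k + r) y.

Lemma block_prob_ge0 l y k x : 0 <= block_prob l y k x.
Proof. by apply: sume_ge0 => r _; exact: prob_at_ge0. Qed.

Lemma block_probS l y k x : E x -> E y ->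
  block_prob l y k.+1 x = kernel_op E (step_kernel P Z l) (block_prob l y k) x.
Proof.
move=> Ex Ey; rewrite /block_prob /kernel_op.
transitivity (\sum_(r < l) \esum_(w in E)
    ((step_kernel P Z l x w)%:E * prob w (l * k + r) y)).
  apply: eq_bigr => r _; rewrite mulnS -addnA.
  exact: (chapman_kolmogorov p_sub Z_markov).
rewrite -esum_sum; last first.
  by move=> w r _ _; rewrite mule_ge0 ?prob_at_ge0// lee_fin (step_kernel_ge0 Z_markov).
by apply: eq_esum => w Ew; rewrite ge0_sume_distrr// => r _; exact: prob_at_ge0.
Qed.

Lemma prob_at_le1 x n y : prob x n y <= 1.
Proof. exact/probability_le1/(chain_measurable Z_markov). Qed.

Lemma block_prob0_le l y x : block_prob l y 0 x <= l%:R%:E.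
Proof.
apply: (@le_trans _ _ (\sum_(r < l) 1%:E)).
  by apply: lee_sum => r _; exact: prob_at_le1.
by rewrite sumEFin sumr_const card_ord.
Qed.

Lemma sum_block_prob l y x N :
  \sum_(k < N) block_prob l y k x = \sum_(0 <= n < l * N) prob x n y.
Proof.
elim: N => [|N IH]; first by rewrite muln0 big_ord0 big_geq.
rewrite big_ord_recr/= IH mulnS addnC [RHS](big_cat_nat (n := l * N))//=.
  congr (_ + _); rewrite -[in RHS](add0n (l * N)%N) big_addn add0n addKn.
  by rewrite big_mkord; apply: eq_bigr => r _; rewrite addnC.
exact: leq_addr.
Qed.

Lemma sum_block_prob_le_green l y x N :
  \sum_(k < N) block_prob l y k x <= green P Z x y.
Proof.
rewrite sum_block_prob; apply: nneseries_lim_ge => n _ _; exact: prob_at_ge0.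
Qed.

Lemma green_le_block l y x (B : \bar R) : (0 < l)%N ->
  (forall N, \sum_(k < N) block_prob l y k x <= B) -> green P Z x y <= B.
Proof.
move=> l0 le_B; apply: lime_le; first exact: is_cvg_nneseries.
apply: nearW => n; apply: le_trans (le_B n); rewrite sum_block_prob.
rewrite [leRHS](big_cat_nat (n := n)) ?leq_pmull//= leeDl//.
by apply: sume_ge0 => i _; exact: prob_at_ge0.
Qed.

Variables (delta K : R).
Hypothesis delta_gt0 : (0 < delta)%R.
Hypothesis K_ge0 : (0 <= K)%R.
Hypothesis exp_moment_le : forall a x, (enorm a <= delta)%R -> E x ->
  exp_moment E P Z a x <= (expR K)%:E.

Lemma block_prob_decay l y k x : E x -> E y -> (0 < norm y)%R ->
  block_prob l y k x <= (l%:R * expR (K * l%:R * k.+1%:R - delta * norm y +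
    delta * \sum_i `|(x 0%R i)%:~R|))%:E.
Proof.
move=> Ex Ey y0; set c := expR _.
apply: (@le_trans _ _ (\sum_(r < l) c%:E)); last first.
  by rewrite sumEFin sumr_const card_ord -(mulr_natl c l).
apply: lee_sum => r _.
apply: le_trans
  (prob_at_decay p_sub Z_markov delta_gt0 exp_moment_le _ Ex Ey y0) _.
rewrite lee_fin ler_expR !lerD2r -mulrA ler_wpM2l// -natrM ler_nat mulnS.
by rewrite addnC leq_add2r ltnW.
Qed.

Variable u : 'rV[int]_d.
Hypothesis E_shift : forall x, E x -> E (x + u)%R.
Hypothesis p_shift :
  forall x y, E x -> E y -> (p x y <= p (x + u) (y + u))%R.
Variables (l : nat) (q : R).
Hypothesis l_gt0 : (0 < l)%N.
Hypothesis q_gt0 : (0 < q)%R.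
Hypothesis q_le : forall x, E x -> q%:E <= prob x l (x + u)%R.

(** Block [k - 1], with value [0] for [k = 0]: block [0] at [z] is then
    estimated together with the others. *)
Let fprev y k (x : 'rV[int]_d) : \bar R :=
  if k is k'.+1 then block_prob l y k' x else 0.

(** For [k] below [K0 + kap |y|] the block itself is negligible by the decay of
    the transition probabilities; above this threshold the comparison of
    consecutive blocks has an error [exp (- 2 c2 k)], half of which is traded
    for decay in the norm of [y].  The slope [kap] balances the growth rate [L]
    of the first bound against its decay rate [delta]. *)
Lemma block_prob_shift (sg : R) z : (0 < sg)%R -> (3 * sg <= 1)%R -> E z ->
  exists D c2 c3 : R, [/\ (0 <= D)%R, (0 < c2)%R, (0 < c3)%R &
    forall y k, E y -> (0 < norm y)%R ->
      (1 - 3 * sg)%:E * block_prob l y k z <=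
      fprev y k (z + u)%R + (D * expR (- (c2 * k%:R) - c3 * norm y))%:E].
Proof.
move=> sg0 sg3 Ez.
pose c := (q * sg ^+ 2 / (1 - sg))%R.
have c0 : (0 < c)%R by rewrite divr_gt0 ?mulr_gt0 ?exprn_gt0//; lra.
pose c2 := (c / 2)%R.
have c20 : (0 < c2)%R by rewrite divr_gt0.
pose L := (K * l%:R)%R.
have L0 : (0 <= L)%R by rewrite mulr_ge0.
pose kap := (delta / 2 / (L + c2))%R.
have kap0 : (0 < kap)%R by rewrite !divr_gt0// ltr_wpDl.
have kapE : ((L + c2) * kap = delta / 2)%R.
  by rewrite /kap mulrC divfK// gt_eqF// ltr_wpDl.
pose K0 := (sg * q)^-1%R.
have K00 : (0 < K0)%R by rewrite invr_gt0 mulr_gt0.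
pose Cz := (delta * \sum_i `|(z 0%R i)%:~R : R|)%R.
have Cz0 : (0 <= Cz)%R by rewrite mulr_ge0 ?(ltW delta_gt0)// sumr_ge0.
pose D := (l%:R * expR (Cz + L + (L + c2) * K0))%R.
pose c3 := Num.min (delta / 2)%R (c2 * kap)%R.
have c30 : (0 < c3)%R.
  by rewrite lt_min; apply/andP; split; [rewrite divr_gt0|rewrite mulr_gt0].
have c3d : (c3 <= delta / 2)%R by rewrite ge_min lexx.
have c3k : (c3 <= c2 * kap)%R by rewrite ge_min lexx orbT.
exists D, c2, c3; split=> //; first by rewrite mulr_ge0 ?expR_ge0.
move=> y k Ey y0; set r := norm y.
have fprev0 : 0 <= fprev y k (z + u)%R.
  by case: k => [|k] //=; exact: block_prob_ge0.
have c3r : (c3 * r <= delta / 2 * r)%R by rewrite ler_wpM2r// ltW.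
have [k_small|k_large] := leP (k%:R) (K0 + kap * r)%R.
  apply: (@le_trans _ _ (block_prob l y k z)).
    by rewrite -[leRHS]mul1e lee_wpmul2r ?block_prob_ge0// lee_fin; lra.
  apply: (le_trans (block_prob_decay l k Ez Ey y0)).
  rewrite -[leLHS]add0e leeD// lee_fin /D -[leRHS]mulrA -expRD ler_wpM2l// ler_expR.
  rewrite -/r -/L -/Cz -natr1.
  have : ((L + c2) * k%:R <= (L + c2) * K0 + delta / 2 * r)%R.
    by rewrite -kapE -mulrA -mulrDr ler_wpM2l// addr_ge0// ltW.
  by lra.
case: k k_large fprev0 => [|k] k_large _.
  by move: k_large; rewrite ltNge addr_ge0 ?(ltW K00)// mulr_ge0 ?ltW.
have kapr : (0 <= kap * r)%R by rewrite mulr_ge0 ?ltW.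
have kbig : (1 <= sg * q * k.+1%:R)%R.
  rewrite mulrC -ler_pdivrMr ?mulr_gt0// div1r -/K0.
  by rewrite (le_trans _ (ltW k_large))// lerDl.
apply: le_trans (shift_almost_dominates (tau := fun x => (x + u)%R)
  (m := step_kernel P Z l) (E := E) (q := q) (f := block_prob l y) (B := l%:R)
  _ _ _ _ _ _ _ _ _ _ sg0 sg3 _ kbig Ez) _ => //.
- exact: addIr.
- by move=> x w _ _; exact: (step_kernel_ge0 Z_markov).
- move=> x w Ex Ew; rewrite -lee_fin !(step_kernelE Z_markov).
  exact: (prob_at_shift p_sub Z_markov).
- by move=> x _; exact: (step_kernel_mass Z_markov).
- by move=> x Ex; rewrite -lee_fin (step_kernelE Z_markov) q_le.
- by move=> i x _; exact: block_prob_ge0.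
- by move=> i x Ex; exact: block_probS.
- by move=> x _; exact: block_prob0_le.
rewrite leeD2l// lee_fin /D -[leRHS]mulrA -expRD ler_wpM2l// ler_expR -/c.
have h1 : (c2 * kap * r <= c2 * k.+1%:R)%R.
  rewrite -mulrA ler_wpM2l ?(ltW c20)// (le_trans _ (ltW k_large))//.
  by rewrite lerDr ltW.
have h2 : (c3 * r <= c2 * kap * r)%R by rewrite ler_wpM2r// ltW.
have h3 : (0 <= Cz + L + (L + c2) * K0)%R.
  by rewrite !addr_ge0// mulr_ge0 ?addr_ge0// ltW.
have -> : c = (c2 + c2)%R by rewrite /c2; lra.
by lra.
Qed.

(** Sum of the block comparisons: the errors form a geometric series in [k]. *)
Lemma green_shift (sg : R) z : (0 < sg)%R -> (3 * sg < 1)%R -> E z ->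
  exists D c : R, [/\ (0 <= D)%R, (0 < c)%R &
    forall y, E y -> (0 < norm y)%R ->
      (1 - 3 * sg)%:E * green P Z z y <=
      green P Z (z + u)%R y + (D * expR (- (c * norm y)))%:E].
Proof.
move=> sg0 sg3 Ez.
have [D [c2 [c3 [D0 c20 c30 bound]]]] := block_prob_shift sg0 (ltW sg3) Ez.
pose rho := expR (- c2).
have rho1 : (rho < 1)%R by rewrite -expR0 ltr_expR oppr_lt0.
have rho0 : (0 < rho)%R by exact: expR_gt0.
pose S := (1 - rho)^-1%R.
have S0 : (0 < S)%R by rewrite invr_gt0 subr_gt0.
exists (D * S)%R, c3; split=> //; first by rewrite mulr_ge0// ltW.
move=> y Ey y0; set r := norm y.
have t0 : (0 < 1 - 3 * sg)%R by lra.
rewrite -lee_pdivlMl//; apply: (green_le_block l_gt0) => N.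
rewrite lee_pdivlMl// ge0_sume_distrr; last by move=> k _; exact: block_prob_ge0.
apply: (@le_trans _ _ (\sum_(k < N) (fprev y k (z + u)%R +
    (D * expR (- (c2 * k%:R) - c3 * r))%:E))).
  by apply: lee_sum => k _; exact: bound.
rewrite big_split/=; apply: leeD.
  case: N => [|N].
    by rewrite big_ord0; apply: nneseries_ge0 => n _ _; exact: prob_at_ge0.
  by rewrite big_ord_recl/= add0e; exact: sum_block_prob_le_green.
rewrite sumEFin lee_fin.
rewrite (eq_bigr (fun k : 'I_N => D * expR (- (c3 * r)) * rho ^+ k)%R); last first.
  move=> k _; rewrite /rho -expRM_natr -mulrA -expRD; congr (_ * expR _)%R.
  by ring.
rewrite -mulr_sumr [leRHS]mulrAC ler_wpM2l ?mulr_ge0 ?expR_ge0//.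
by apply: geometric_sum_le => //; exact: ltW.
Qed.

End green_function.

(** * Passage to the limit *)

Lemma limn_einf_gt_near {R : realType} (v : (\bar R)^nat) (a : \bar R) :
  (a < limn_einf v)%E -> \forall n \near \oo, (a < v n)%E.
Proof.
rewrite limn_einf_lim (cvg_lim _ (@cvg_einfs_sup _ v))//.
move=> /ereal_sup_gt[_ [N _ <-] aN]; exists N => // n /= Nn.
apply: lt_le_trans aN _; apply: ereal_inf_lbound.
by exists n.
Qed.

Lemma near_subsequence (phi : nat -> nat) (Q : nat -> Prop) :
  (forall m n, (m < n)%N -> (phi m < phi n)%N) ->
  (\forall n \near \oo, Q n) -> \forall k \near \oo, Q (phi k).
Proof.
move=> phi_incr [N _ QN]; exists N => // k /= Nk; apply: QN => /=.
apply: (leq_trans Nk); elim: k {Nk} => // k IH.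
exact: leq_ltn_trans IH (phi_incr _ _ (ltnSn k)).
Qed.

Lemma le_up_to_factor_and_error {R : realType} (a b : R) :
  (forall sg eps, 0 < sg -> 3 * sg < 1 -> 0 < eps ->
    (1 - 3 * sg) * a <= b + eps) -> a <= b.
Proof.
move=> H; apply/ler_addgt0Pr => e e0.
pose sg := Num.min (1 / 6) (e / 2 / (3 * (`|a| + 1))).
have pos : 0 < 3 * (`|a| + 1) by rewrite mulr_gt0// ltr_wpDl.
have sg0 : 0 < sg by rewrite lt_min !divr_gt0.
have sg1 : sg <= 1 / 6 by rewrite ge_min lexx.
have sg2 : sg * (3 * (`|a| + 1)) <= e / 2.
  by rewrite -ler_pdivlMr// ge_min lexx orbT.
have e20 : 0 < e / 2 by rewrite divr_gt0.
have := H sg (e / 2) sg0 _ e20.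
have a1 : sg * a <= sg * (`|a| + 1).
  by rewrite ler_wpM2l ?ltW// (le_lt_trans (ler_norm a))// ltrDl.
by lra.
Qed.

Theorem corollary2p1 (R : realType) (d : nat)
  (E : set 'rV[int]_d) (p : 'rV[int]_d -> 'rV[int]_d -> R)
  (disp : measure_display) (Omega : measurableType disp)
  (P : 'rV[int]_d -> probability Omega R)
  (Z : nat -> Omega -> option 'rV[int]_d)
  (p_substochastic : substochastic E p)
  (Z_markov : is_markov_chain E p P Z)
  (Z_transient : transient E P Z)
  (A1 : irreducible_chain E P Z)
  (A2 : exists C delta0 : R, [/\ 0 < C, 0 < delta0 &
     (ereal_sup [set ereal_sup [set exp_moment E P Z a x | x in E]
                | a in [set a : 'rV[R]_d | (enorm a <= delta0)%R]] < C%:E)%E])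
  (A3' : E 0 /\ forall u, E u ->
     [set x + u | x in E] `<=` E /\
     forall x y, E x -> E y -> p x y <= p (x + u) (y + u))
  (A4' : forall u, E u -> u <> 0 -> exists n : nat,
     (0 < ereal_inf [set prob_at P Z x n (x + u)%R | x in E])%E)
  (y : nat -> 'rV[int]_d) (y_E : forall n, E (y n))
  (y_infty : enorm (embed (y n) : 'rV[R]_d) @[n --> \oo] --> +oo)
  (y_green : (0 <= limn_einf (fun n =>
     ((enorm (embed (y n) : 'rV[R]_d))^-1 * ln (fine (green P Z 0 (y n))))%:E))%E)
  (phi : nat -> nat) (phi_incr : forall m n, (m < n)%N -> (phi m < phi n)%N)
  (Keta : 'rV[int]_d -> R)
  (Keta_lim : martin_cvg E P Z (fun k => y (phi k)) Keta) :
  forall z u, E z -> E u -> Keta z <= Keta (z + u).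
Proof.
move=> z u Ez Eu; have [->|u0] := eqVneq u 0; first by rewrite addr0.
have [E0 shift] := A3'; have [Eadd p_shift] := shift u Eu.
have E_shift x : E x -> E (x + u) by move=> Ex; apply: Eadd; exists x.
have [C [delta [C0 delta0 expC]]] := A2.
(* [C <= exp C], so that [C] itself bounds the growth exponent per step *)
have exp_le a x : enorm a <= delta -> E x ->
    (exp_moment E P Z a x <= (expR C)%:E)%E.
  move=> ad Ex; apply: (@le_trans _ _ C%:E); last first.
    by rewrite lee_fin (le_trans _ (expR_ge1Dx _))// lerDr.
  apply: le_trans (ltW expC).
  apply: (@le_trans _ _ (ereal_sup [set exp_moment E P Z a x | x in E])).
    by apply: ereal_sup_ubound; exists x.
  by apply: ereal_sup_ubound; exists a.
have [l inf_gt0] := A4' u Eu (elimN eqP u0).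
have q_lb x : E x -> (ereal_inf [set prob_at P Z x l (x + u) | x in E] <=
    prob_at P Z x l (x + u))%E.
  by move=> Ex; apply: ereal_inf_lbound; exists x.
have [q q0 q_le] : exists2 q : R, 0 < q &
    forall x, E x -> (q%:E <= prob_at P Z x l (x + u))%E.
  exists (fine (ereal_inf [set prob_at P Z x l (x + u) | x in E])).
    rewrite fine_gt0// inf_gt0 (le_lt_trans (q_lb _ E0))//.
    by rewrite (le_lt_trans (prob_at_le1 Z_markov _ _ _))// ltry.
  move=> x Ex; rewrite fineK ?q_lb// ge0_fin_numE ?ltW//.
  rewrite (le_lt_trans (q_lb _ E0))//.
  by rewrite (le_lt_trans (prob_at_le1 Z_markov _ _ _))// ltry.
(* no step of length [0] moves by [u <> 0] *)
have l0 : (0 < l)%N.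
  rewrite lt0n; apply/eqP => l0; have := q_le _ E0.
  rewrite l0 (prob_at0 Z_markov)// add0r eq_sym (negPf u0) lee_fin.
  by rewrite leNgt q0.
have green_ge0 x v : (0 <= green P Z x v)%E.
  by apply: nneseries_ge0 => n _ _; exact: prob_at_ge0.
have green_fin x v : E x -> E v -> green P Z x v \is a fin_num.
  by move=> Ex Ev; rewrite ge0_fin_numE// Z_transient.
have G0 n : 0 < fine (green P Z 0 (y n)).
  rewrite fine_gt0// Z_transient// andbT.
  have [m m0] := A1 _ _ E0 (y_E n); apply: (lt_le_trans m0).
  apply: le_trans (nneseries_lim_ge (m.+1) _); last first.
    by move=> i _ _; exact: prob_at_ge0.
  rewrite big_nat_recr//= leeDr// sume_ge0// => i _; exact: prob_at_ge0.
have approx sg eps : 0 < sg -> 3 * sg < 1 -> 0 < eps ->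
    (1 - 3 * sg) * Keta z <= Keta (z + u) + eps.
  move=> sg0 sg3 eps0.
  have [D [c [D0 c0 Gshift]]] := green_shift p_substochastic Z_markov delta0
    (ltW C0) exp_le E_shift p_shift l0 q0 q_le sg0 sg3 Ez.
  have [_ _ K_lim] := Keta_lim.
  have lim1 : (1 - 3 * sg) * martin_kernel P Z z (y (phi n)) @[n --> \oo]
      --> (1 - 3 * sg) * Keta z by apply: cvgMr; exact: K_lim.
  have lim2 : martin_kernel P Z (z + u) (y (phi n)) + eps @[n --> \oo]
      --> Keta (z + u) + eps.
    by apply: cvgD; [exact/K_lim/E_shift|exact: cvg_cst].
  apply: ler_cvg_to lim1 lim2 _.
  apply: (@near_subsequence phi (fun n =>
    (1 - 3 * sg) * martin_kernel P Z z (y n) <=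
    martin_kernel P Z (z + u) (y n) + eps)) => //.
  have c20 : 0 < c / 2 by rewrite divr_gt0.
  have lower : \forall n \near \oo, ((- (c / 2))%:E <
      ((enorm (embed (y n) : 'rV[R]_d))^-1 * ln (fine (green P Z 0 (y n))))%:E)%E.
    apply: limn_einf_gt_near; apply: lt_le_trans y_green.
    by rewrite lte_fin oppr_lt0.
  have /cvgryPgt norm_large := y_infty.
  near=> n.
  have r0 : 0 < enorm (embed (y n) : 'rV[R]_d) by near: n.
  have r_large : D / (c / 2 * eps) < enorm (embed (y n) : 'rV[R]_d) by near: n.
  have ln_large : - (c / 2) <
      (enorm (embed (y n) : 'rV[R]_d))^-1 * ln (fine (green P Z 0 (y n))).
    by rewrite -lte_fin; near: n.
  move: r0 r_large ln_large.
  set r := enorm _; set g := fine _ => r0 r_large ln_large.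
  have g0 : 0 < g by exact: G0.
  have g_lower : expR (- (c / 2) * r) <= g.
    rewrite -[leRHS]lnK ?posrE// ler_expR.
    by move: ln_large; rewrite [_^-1 * _]mulrC ltr_pdivlMr// => /ltW.
  (* [exp t >= t] with [t = c r / 2] is enough, as [r] is large *)
  have err : D * expR (- (c * r)) <= eps * g.
    apply: (@le_trans _ _ (eps * expR (- (c / 2) * r))); last first.
      by rewrite ler_wpM2l// ltW.
    have -> : expR (- (c * r)) = expR (- (c / 2 * r)) * expR (- (c / 2) * r).
      by rewrite -expRD; congr expR; field.
    rewrite mulrA ler_wpM2r ?expR_ge0// expRN ler_pdivrMr ?expR_gt0//.
    apply: (@le_trans _ _ (eps * (c / 2 * r))).
      have -> : eps * (c / 2 * r) = r * (c / 2 * eps) by ring.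
      by rewrite -ler_pdivrMr ?mulr_gt0// ltW.
    by rewrite ler_wpM2l ?(ltW eps0)// (le_trans _ (expR_ge1Dx _))// lerDr.
  have := Gshift _ (y_E n) r0; rewrite -/r.
  rewrite -(fineK (green_fin _ _ Ez (y_E n))).
  rewrite -(fineK (green_fin _ _ (E_shift _ Ez) (y_E n))).
  rewrite -EFinM -EFinD lee_fin /martin_kernel -/g => main.
  rewrite mulrA ler_pdivrMr// [leRHS]mulrDl divfK ?gt_eqF//.
  by apply: (le_trans main); rewrite lerD2l.
exact: le_up_to_factor_and_error approx.
Unshelve. all: by end_near.
Qed.
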